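(* Let $G$ be a finite simple graph with no isolated vertices. Then $Z(G)\leq Z(L(G))$.
   Context: For a finite simple graph $H$: colour each vertex black or white. A black vertex $v$ may force a white neighbour $w$ to become black if $w$ is the only white neighbour of $v$. A set $S\subseteq V(H)$ is a zero-forcing set if, colouring exactly the vertices of $S$ black and repeatedly applying this rule, all vertices eventually become black. The zero-forcing number $Z(H)$ is the minimum size of a zero-forcing set. $L(G)$ denotes the line graph of $G$: its vertices are the edges of $G$, two being adjacent iff they share an endpoint in $G$. *)

(* Defs.v *)
From mathcomp Require Import all_boot.
Set Implicit Arguments.
Unset Strict Implicit.
Unset Printing Implicit Defensive.

Record sgraph := SGraph {
  vertex :> finType;
  adj : rel vertex;
  adj_sym : symmetric adj;
  adj_irr : irreflexive adj }.

Definition no_isolated_vertex (G : sgraph) : Prop :=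
  forall v : G, exists w : G, adj v w.

Section ZeroForcing.
Variable H : sgraph.

(* [B] is the set of black vertices. *)
Definition can_force (B : {set H}) (v w : H) : bool :=
  [&& v \in B, w \notin B, adj v w &
      [forall u, (adj v u && (u \notin B)) ==> (u == w)]].

Definition force_step (B B' : {set H}) : bool :=
  [exists v, exists w, can_force B v w && (B' == w |: B)].

(* [connect] is the reflexive-transitive closure: finitely many single forces
   lead from the colouring [S] to the all-black one. *)
Definition zero_forcing (S : {set H}) : bool := connect force_step S [set: H].

(* The minimum is attained: [set: H] is always zero-forcing. *)
Lemma zero_forcingT : zero_forcing [set: H].
Proof. exact: connect0. Qed.

Definition zero_forcing_number : nat :=
  #|[arg min_(S < [set: H] | zero_forcing S) #|S|]|.

Lemma zero_forcing_numberP :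
  (exists2 S, zero_forcing S & #|S| = zero_forcing_number) /\
  (forall S, zero_forcing S -> zero_forcing_number <= #|S|).
Proof.
rewrite /zero_forcing_number.
by case: arg_minnP => [|S zS minS]; [exact: zero_forcingT | split=> //; exists S].
Qed.

End ZeroForcing.

Section LineGraph.
Variable G : sgraph.

Definition is_edge (A : {set G}) : bool :=
  [exists u, exists v, adj u v && (A == [set u; v])].

Definition edge : finType := {A : {set G} | is_edge A}.

Definition edge_adj (a b : edge) : bool :=
  (a != b) && [exists x, (x \in val a) && (x \in val b)].

Lemma edge_adj_sym : symmetric edge_adj.
Proof.
move=> a b; rewrite /edge_adj eq_sym; congr andb.
by apply: eq_existsb => x; rewrite andbC.
Qed.

Lemma edge_adj_irr : irreflexive edge_adj.
Proof. by move=> a; rewrite /edge_adj eqxx. Qed.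

Definition line_graph : sgraph := SGraph edge_adj_sym edge_adj_irr.

End LineGraph.

(* Main.v *)
Require Import Defs.
From mathcomp Require Import all_boot.

(** Let [F] be a zero-forcing set of [L(G)].  When the black edge [uv] forces
[vw], all edges at [u] and all edges at [v] except [vw] are black; so in [G],
if every vertex touched by a black edge is black, [v] can force [w].  Hence the
set of vertices touched by [F] is zero-forcing in [G].  It has at most
[#|F| + c] elements, where [c] is the number of components of the graph formed
by the edges of [F], and one vertex can be saved in each component: if the
component contains a saturated vertex [x] (all its edges are in [F]), leave out
a neighbour of [x], which [x] forces at once; otherwise leave out the vertex
[w] at which the component is first reached by a force [uv -> vw], since [v]
then forces [w]. *)

Set Implicit Arguments.
Unset Strict Implicit.
Unset Printing Implicit Defensive.

(** * Zero forcing through stalled colourings *)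

Section Stalled.
Variable H : sgraph.
Implicit Types S T : {set H}.

Definition stalled T := forall v w, ~~ can_force T v w.

(** Phrased by stalled supersets instead of force sequences, so that enlarging a set amounts to
    showing that every stalled colouring above it contains the missing vertices. *)
Definition stalls_only_full S := forall T, S \subset T -> stalled T -> T = setT.

Lemma stalled_forced T v w :
  stalled T -> v \in T -> adj v w ->
  (forall u, adj v u -> u != w -> u \in T) -> w \in T.
Proof.
move=> stT vT vw nbT; apply: contraT => wT.
rewrite -(negbTE (stT v w)) /can_force vT wT vw /=.
apply/forallP => u; apply/implyP => /andP[vu]; apply: contraNT.
exact: nbT.
Qed.

(** Induction on the number of white vertices: the property passes to supersets, so any available
    force may be made; if there is none, [S] itself is stalled and hence full. *)
Lemma stalls_only_full_zero_forcing S : stalls_only_full S -> zero_forcing S.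
Proof.
move=> zS; rewrite /zero_forcing.
have [n] := ubnP #|~: S|; elim: n S zS => // n IHn S zS ltn.
have [/existsP[v /existsP[w vw]]|stS] := boolP [exists v, exists w, can_force S v w].
  have wS : w \notin S by case/and4P: vw.
  apply: (@connect_trans _ _ (w |: S)).
    by apply/connect1/existsP; exists v; apply/existsP; exists w; rewrite vw /=.
  apply: IHn => [T sT|]; first by apply: zS; apply: subset_trans (subsetUr _ _) sT.
  rewrite -ltnS; apply: leq_trans ltn; rewrite ltnS; apply: proper_card.
  rewrite properC properE subsetUr /=; apply/subsetPn.
  by exists w; rewrite ?setU11.
suff -> : S = setT by exact: connect0.
apply: zS => // v w; apply: contra stS => vw.
by apply/existsP; exists v; apply/existsP; exists w.
Qed.

End Stalled.

(** * The subgraph of [G] formed by a set of edges *)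

Section EdgeSets.
Variable G : sgraph.
Implicit Types (x y z u v w : G) (B : {set line_graph G}).

Lemma adj_neq x y : adj x y -> x != y.
Proof. by apply: contraTneq => ->; rewrite adj_irr. Qed.

Lemma edge_ofP x y : adj x y -> {e : edge G | val e = [set x; y]}.
Proof.
move=> xy; have exy : is_edge [set x; y].
  by apply/existsP; exists x; apply/existsP; exists y; rewrite xy /=.
by exists (exist (fun A : {set G} => is_edge A) _ exy).
Qed.

Lemma set2_inj x y z : [set x; y] = [set x; z] -> y = z.
Proof.
move=> E; have : y \in [set x; z] by rewrite -E set22.
have : z \in [set x; y] by rewrite E set22.
by rewrite !inE; do 2 case/orP=> /eqP ?; subst.
Qed.

Lemma edge_set2P (e : edge G) x :
  x \in val e -> exists2 y, adj x y & val e = [set x; y].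
Proof.
case/existsP: (valP e) => u /existsP[v /andP[uv /eqP ->]].
rewrite !inE => /orP[]/eqP->; first by exists v.
by exists u; rewrite 1?adj_sym // setUC.
Qed.

Definition joined B : rel G :=
  [rel x y | [exists e : edge G, (e \in B) && (val e == [set x; y])]].

Definition touched B : {set G} := [set x | [exists y, joined B x y]].

Definition saturated B : {set G} :=
  [set x | [forall y, adj x y ==> joined B x y]].

Lemma joinedP B x y :
  reflect (exists2 e : edge G, e \in B & val e = [set x; y]) (joined B x y).
Proof.
apply: (iffP existsP) => [[e /andP[eB /eqP]]|[e eB exy]]; first by exists e.
by exists e; rewrite eB exy /=.
Qed.

Lemma joined_sym B : symmetric (joined B).
Proof. by move=> x y; rewrite /joined /= setUC. Qed.

Lemma connect_joinedC B : connect_sym (joined B).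
Proof. exact/sym_connect_sym/joined_sym. Qed.

Lemma joined_adj B x y : joined B x y -> adj x y.
Proof.
case/joinedP=> e _ E; have xe : x \in val e by rewrite E set21.
by have [z xz Ez] := edge_set2P xe; rewrite (@set2_inj x y z) -?E.
Qed.

Lemma touchedP B x : reflect (exists y, joined B x y) (x \in touched B).
Proof. by rewrite inE; exact: existsP. Qed.

Lemma joined_touched B x y : joined B x y -> x \in touched B.
Proof. by move=> xy; apply/touchedP; exists y. Qed.

Lemma saturated_joined B x y : x \in saturated B -> adj x y -> joined B x y.
Proof. by rewrite inE => /forallP/(_ y)/implyP. Qed.

Lemma joined_sub B B' : B \subset B' -> subrel (joined B) (joined B').
Proof.
move=> sB x y /joinedP[e eB exy]; apply/joinedP; exists e => //.
exact: (subsetP sB).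
Qed.

Lemma connect_joined_sub B B' : B \subset B' ->
  subrel (connect (joined B)) (connect (joined B')).
Proof.
move=> sB; apply: connect_sub => x y xy.
exact/connect1/(joined_sub sB).
Qed.

Lemma saturated_sub B B' : B \subset B' -> saturated B \subset saturated B'.
Proof.
move=> sB; apply/subsetP=> x sx; rewrite inE; apply/forallP=> y.
by apply/implyP=> xy; apply: (joined_sub sB); apply: saturated_joined.
Qed.

Lemma joinedT x y : adj x y -> joined setT x y.
Proof. by move=> xy; have [e E] := edge_ofP xy; apply/joinedP; exists e. Qed.

Lemma joinedU1 B (f : edge G) x y :
  joined (f |: B) x y -> joined B x y \/ val f = [set x; y].
Proof.
case/joinedP=> e /setU1P[->|eB] E; first by right.
by left; apply/joinedP; exists e.
Qed.

(** The new edge lies outside the component of [x] in [B], so a path from [x] never gets to use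
    it. *)
Lemma connect_joinedU1 B (f : edge G) x y :
  (forall z, z \in val f -> ~~ connect (joined B) x z) ->
  connect (joined (f |: B)) x y -> connect (joined B) x y.
Proof.
move=> nf /connectP[p]; elim/last_ind: p y => [|p z IHp] y /=.
  by move=> _ ->; apply: connect0.
rewrite rcons_path last_rcons => /andP[pth pz] ->.
have xl := IHp _ pth erefl; apply: (connect_trans xl).
case/joinedU1: pz => [/connect1 //|E].
by have := nf (last x p); rewrite E set21 xl => /(_ isT).
Qed.

Lemma saturatedU1 B (f : edge G) x :
  x \notin val f -> x \in saturated (f |: B) -> x \in saturated B.
Proof.
move=> xf sx; rewrite inE; apply/forallP=> y; apply/implyP=> xy.
case/joinedU1: (saturated_joined sx xy) => // E.
by rewrite E set21 in xf.
Qed.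

Lemma line_can_forceP B (e f : line_graph G) : can_force B e f ->
  exists u, exists v, exists w,
    [/\ u \in saturated B, joined B u v, adj v w, val f = [set v; w] &
        forall z, adj v z -> z != w -> joined B v z].
Proof.
case/and4P=> eB fB /andP[nef /existsP[v /andP[ve vf]]] /forallP only.
have [u vu Ee] := edge_set2P ve; have [w vw Ef] := edge_set2P vf.
have nuw : u != w by apply: contraNneq nef => uw; apply/eqP/val_inj; rewrite Ee Ef uw.
(* [f] is the only white neighbour of the black edge [e], so every other edge meeting [e] is
   black. *)
have black (g : edge G) t : t \in val e -> t \in val g -> g != f -> g \in B.
  move=> te tg; have [<- //|neg] := eqVneq e g; apply: contraNT => gB.
  apply: (implyP (only g)); rewrite gB andbT /= /edge_adj neg /=.
  by apply/existsP; exists t; rewrite te.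
exists u, v, w; split=> //.
- rewrite inE; apply/forallP=> y; apply/implyP=> uy.
  have [g Eg] := edge_ofP uy; apply/joinedP; exists g => //.
  apply: (black g u); rewrite ?Ee ?Eg ?set21 ?set22 //.
  apply: contra_neq nuw => gf; have : u \in val f by rewrite -gf Eg set21.
  by rewrite Ef !inE eq_sym (negPf (adj_neq vu)) => /eqP.
- by apply/joinedP; exists e; rewrite // Ee setUC.
- move=> z vz nzw; have [g Eg] := edge_ofP vz; apply/joinedP; exists g => //.
  apply: (black g v); rewrite ?Eg ?set21 //.
  by apply: contra_neq nzw => gf; apply: (@set2_inj v); rewrite -Eg gf.
Qed.

(* Spanning forest count: a maximal [W] containing [D] with
   [#|W :\: D|] at most the number of edges of [B] inside [W] absorbs every
   vertex reachable from [D], since each new vertex comes with a new edge. *)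
Lemma card_connected_le B (D A : {set G}) :
  (forall v, v \in A -> exists2 d, d \in D & connect (joined B) d v) ->
  #|A :\: D| <= #|B|.
Proof.
move=> cD; pose inside (W : {set G}) := [set e in B | val (e : edge G) \subset W].
pose ok (W : {set G}) := (D \subset W) && (#|W :\: D| <= #|inside W|).
have okD : ok D by rewrite /ok subxx setDv cards0.
have [W /maxsetP[/andP[DW leW] maxW] _] := maxset_exists okD.
suff AW : A \subset W.
  apply: leq_trans (subset_leq_card (setSD D AW)) (leq_trans leW _).
  by apply/subset_leq_card/subsetP=> e; rewrite inE => /andP[].
apply/subsetP=> v /cD[d dD]; have {dD} := subsetP DW _ dD.
suff step a b : a \in W -> joined B a b -> b \in W.
  move=> + /connectP[p]; elim: p d => [|b p IHp] a aW /=; first by move=> _ ->.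
  by case/andP=> ab pth ev; apply: IHp pth ev; apply: step ab.
move=> aW /joinedP[e eB Ee]; apply: contraT => bW.
suff okW : ok (b |: W) by rewrite -(maxW _ okW (subsetUr _ _)) setU11 in bW.
rewrite /ok (subset_trans DW (subsetUr _ _)) /=.
have bD : b \notin D by apply: contra bW; apply: (subsetP DW).
have -> : (b |: W) :\: D = b |: (W :\: D).
  by apply/setP=> z; rewrite !inE; case: eqVneq => [->|//]; rewrite (negPf bD).
rewrite cardsU1 !inE (negPf bW) andbF add1n.
apply: leq_ltn_trans leW (proper_card _); apply/properP; split.
  apply/subsetP=> g; rewrite !inE => /andP[-> gW] /=.
  exact: subset_trans gW (subsetUr _ _).
exists e; rewrite !inE eB Ee /=.
  by rewrite subUset !sub1set setU11 setU1r.
by apply/negP; rewrite subUset !sub1set (negPf bW) andbF.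
Qed.

(** * Omitted vertices, followed backwards along the forces *)

Definition reaches_saturated B : {set G} :=
  [set v | [exists x in saturated B, connect (joined B) v x]].

Lemma reaches_saturatedP B v :
  reflect (exists2 x, x \in saturated B & connect (joined B) v x)
          (v \in reaches_saturated B).
Proof. by rewrite inE; exact: exists_inP. Qed.

Lemma reaches_saturated_connect B v w :
  connect (joined B) v w -> w \in reaches_saturated B -> v \in reaches_saturated B.
Proof.
move=> vw /reaches_saturatedP[x sx wx]; apply/reaches_saturatedP; exists x => //.
exact: connect_trans vw wx.
Qed.

Lemma reaches_saturated_sub B B' :
  B \subset B' -> reaches_saturated B \subset reaches_saturated B'.
Proof.
move=> sB; apply/subsetP=> v /reaches_saturatedP[x sx vx].
apply/reaches_saturatedP; exists x; first exact: (subsetP (saturated_sub sB)).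
exact: (connect_joined_sub sB).
Qed.

(* [R] plays the role of the vertices left out of the components of [B] that
   have no saturated vertex. *)
Definition omittable B (R : {set G}) : Prop :=
  [/\ stalls_only_full (touched B :\: R),
      [disjoint R & reaches_saturated B] &
      forall v, v \in touched B -> v \notin reaches_saturated B ->
        exists2 r, r \in R & connect (joined B) r v].

(** With all edges black every vertex is saturated, so nothing is omitted; without isolated vertices
    every vertex is touched. *)
Lemma omittable_setT (hG : no_isolated_vertex G) : omittable setT set0.
Proof.
have satT v : v \in reaches_saturated setT.
  apply/reaches_saturatedP; exists v; last exact: connect0.
  by rewrite inE; apply/forallP=> y; apply/implyP; apply: joinedT.
split=> [T sT _| | v _]; last by rewrite satT.
  apply/setP=> v; rewrite in_setT; apply: (subsetP sT); rewrite setD0.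
  by have [w /joinedT/joined_touched] := hG v.
by rewrite disjoint_sym disjoints_subset setC0 subsetT.
Qed.

(** Passing back over the force [uv -> vw], the vertex [w] is omitted too, unless its component in
    [B] already has a saturated vertex. *)
Lemma omittable_step B B' : force_step B B' ->
  (exists R, omittable B' R) -> exists R, omittable B R.
Proof.
case/existsP=> e /existsP[f /andP[ef /eqP ->]] [R' [zR' dR' cR']].
have [u [v [w [su uv vw Ef vnb]]]] := line_can_forceP ef.
have sB : B \subset f |: B by apply: subsetUr.
have sv : v \in reaches_saturated B.
  by apply/reaches_saturatedP; exists u; rewrite // connect_joinedC; apply: connect1.
pose R := R' :|: ([set w] :\: reaches_saturated B).
have dR : [disjoint R & reaches_saturated B].
  rewrite disjoints_subset subUset -!disjoints_subset.
  rewrite (disjointWr (reaches_saturated_sub sB) dR') /=.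
  by rewrite disjoints_subset setDE subsetIr.
exists R; split=> // [T sT stT|x tx nx].
  have inT z : z \in touched B -> z \in reaches_saturated B -> z \in T.
    move=> tz sz; apply: (subsetP sT); rewrite inE tz andbT.
    by rewrite (disjointFl dR sz).
  (* The neighbours of [v] other than [w] are joined to [v], hence in the component of the saturated
     [u], where nothing is omitted. So [v] would force [w]. *)
  have wT : w \in T.
    apply: (stalled_forced (v := v)) => //.
      by apply: inT => //; move: uv; rewrite joined_sym => /joined_touched.
    move=> z vz nzw; have := vnb z vz nzw; rewrite joined_sym => zv.
    apply: inT; first exact: joined_touched zv.
    exact: reaches_saturated_connect (connect1 zv) sv.
  (* The only vertex that [f] can newly touch is [w], since [v] is touched by [uv]. *)
  apply: zR' => //; apply/subsetP=> z /setDP[+ zR'].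
  have [-> //|nzw] := eqVneq z w.
  case/touchedP=> y /joinedU1 zy; apply: (subsetP sT).
  rewrite in_setD in_setU (negPf zR') !inE (negPf nzw) andbF /=.
  apply/existsP; case: zy => [|E]; first by exists y.
  have : z \in val f by rewrite E set21.
  by rewrite Ef !inE (negPf nzw) orbF => /eqP ->; exists u; rewrite joined_sym.
(* Either [w] represents the component of [x], or [f] misses that component, which then stays the
   same and unsaturated in [f |: B], so [R'] represents it. *)
have [xw|nxw] := boolP (connect (joined B) x w).
  exists w; last by rewrite connect_joinedC.
  rewrite in_setU in_setD set11 andbT; apply/orP; right.
  by apply: contra nx; apply: reaches_saturated_connect.
have nxf z : z \in val f -> ~~ connect (joined B) x z.
  rewrite Ef !inE => /orP[]/eqP-> //; apply: contra nx => xv.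
  exact: reaches_saturated_connect xv sv.
have [||r rR' rx] := cR' x.
- by case/touchedP: tx => y xy; apply: joined_touched (joined_sub sB xy).
- apply: contra nx => /reaches_saturatedP[y sy xy].
  have {}xy := connect_joinedU1 nxf xy.
  apply/reaches_saturatedP; exists y => //; apply: saturatedU1 sy.
  by apply: contraTN xy => /nxf.
exists r; first by rewrite in_setU rR'.
by rewrite connect_joinedC; apply: (connect_joinedU1 nxf); rewrite connect_joinedC.
Qed.

Lemma zero_forcing_omittable (hG : no_isolated_vertex G) B :
  zero_forcing B -> exists R, omittable B R.
Proof.
case/connectP=> p; elim: p B => [|B' p IHp] B /=.
  by move=> _ <-; exists set0; apply: omittable_setT.
by case/andP=> BB' pth lst; apply: omittable_step BB' (IHp _ pth lst).
Qed.

(** * Saving one vertex in each component *)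

Definition saturated_nbr B r : G :=
  odflt r [pick z | connect (joined B) r z && [exists x in saturated B, adj x z]].

(** A saturated vertex has a neighbour, and is joined to it, so the [pick] succeeds and the default
    [r] is not returned. *)
Lemma saturated_nbrP (hG : no_isolated_vertex G) B r :
  r \in reaches_saturated B ->
  connect (joined B) r (saturated_nbr B r) /\
  exists2 x, x \in saturated B & adj x (saturated_nbr B r).
Proof.
case/reaches_saturatedP=> x sx rx; rewrite /saturated_nbr.
case: pickP => [z /andP[rz /exists_inP] //|/= none].
have [y xy] := hG x; have := none y.
rewrite (connect_trans rx (connect1 (saturated_joined sx xy))) /=.
by move/exists_inP=> []; exists x.
Qed.

Lemma omittable_zero_forcing (hG : no_isolated_vertex G) B R :
  omittable B R -> exists2 S : {set G}, zero_forcing S & #|S| <= #|B|.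
Proof.
(* Evaluating at the root makes [c] constant on each component. *)
case=> zR dR cR; pose c v := saturated_nbr B (root (joined B) v).
have cP v : v \in reaches_saturated B ->
    connect (joined B) v (c v) /\ exists2 x, x \in saturated B & adj x (c v).
  move=> sv; have vr := connect_root (joined B) v.
  have [|rc sx] := saturated_nbrP hG (B := B) (r := root (joined B) v).
    by apply: reaches_saturated_connect sv; rewrite connect_joinedC.
  by split=> //; apply: connect_trans vr rc.
pose Y := [set c v | v in reaches_saturated B].
exists (touched B :\: (R :|: Y)); last first.
  (* [R :|: Y] meets the component of every touched vertex. *)
  apply: card_connected_le => v tv.
  have [sv|nsv] := boolP (v \in reaches_saturated B).
    exists (c v); first by rewrite inE imset_f ?orbT.
    by rewrite connect_joinedC; have [] := cP v sv.
  by have [r rR rv] := cR v tv nsv; exists r; rewrite // inE rR.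
apply: stalls_only_full_zero_forcing => T sT stT; apply: zR => //.
apply/subsetP=> y /setDP[ty yR].
have [/imsetP[v sv yv]|yY] := boolP (y \in Y); last first.
  by apply: (subsetP sT); rewrite in_setD in_setU negb_or yR yY.
have [vy [x sx xy]] := cP v sv; rewrite -yv in vy xy.
(* In the component of [x] only [y] is omitted: [R] avoids it, and members of [Y] in one component
   share a root and so coincide. Hence [x] forces [y]. *)
have inT z : z \in touched B -> connect (joined B) z x -> z != y -> z \in T.
  move=> tz zx; apply: contraNT => zT.
  have sz : z \in reaches_saturated B by apply/reaches_saturatedP; exists x.
  have : z \in R :|: Y.
    by apply: contraNT zT => zD; apply: (subsetP sT); rewrite inE zD.
  rewrite inE (disjointFl dR sz) => /imsetP[v' sv' zv'].
  have [v'z _] := cP v' sv'; rewrite -zv' in v'z.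
  rewrite zv' yv /c; suff /(rootP (@connect_joinedC B)) -> :
    connect (joined B) v' v by [].
  apply: connect_trans v'z (connect_trans zx _).
  rewrite connect_joinedC; apply: connect_trans vy _.
  by rewrite connect_joinedC; apply/connect1/saturated_joined.
apply: (stalled_forced (v := x)) => //.
  apply: inT; rewrite ?connect0 ?adj_neq //.
  exact: joined_touched (saturated_joined sx xy).
move=> z xz; have := saturated_joined sx xz; rewrite joined_sym => zx.
by apply: inT; [apply: joined_touched zx | apply: connect1].
Qed.

End EdgeSets.

Theorem theorem4 (G : sgraph) (hG : no_isolated_vertex G) :
  zero_forcing_number G <= zero_forcing_number (line_graph G).
Proof.
have [[F zF <-] _] := zero_forcing_numberP (line_graph G).
have [R oR] := zero_forcing_omittable hG zF.
have [S zS leS] := omittable_zero_forcing hG oR.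
by have [_ /(_ S zS) minS] := zero_forcing_numberP G; apply: leq_trans leS.
Qed.
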